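(* Let $M$ be a connected matroid of rank $2$ on the ground set $\{1,\ldots,n\}$. Suppose that $M$ has exactly $s$ hyperplanes, of sizes $a_1,\ldots,a_s$. Then $s\geq 3$ and \[ \operatorname{ehr}(\mathscr{P}(M),t)\ =\ \binom{2t+n-1}{n-1}-\sum_{i=1}^{s}P_{a_i,n}(t), \] where, for $1\leq a\leq n$, \[ P_{a,n}(t):=\sum_{k=1}^{a}\binom{t+n-k-1}{n-k}\binom{t+k-1}{k-1}. \]
   Context: For a matroid $M$ on $\{1,\ldots,n\}$ with set of bases $\mathscr{B}$, the matroid (base) polytope is $\mathscr{P}(M)=\operatorname{conv}\{e_B : B\in\mathscr{B}\}\subseteq\mathbb{R}^n$, where $e_B=\sum_{i\in B}e_i$. For a lattice polytope $\mathscr{P}\subseteq\mathbb{R}^n$, its Ehrhart polynomial $\operatorname{ehr}(\mathscr{P},t)$ is the polynomial in $t$ with $\operatorname{ehr}(\mathscr{P},t)=\#(t\mathscr{P}\cap\mathbb{Z}^n)$ for all integers $t\geq 0$. A hyperplane of a matroid $M$ is a flat of rank $\operatorname{rk}(M)-1$. A matroid is connected if it is not a direct sum of matroids on smaller ground sets. Binomial coefficients $\binom{t+c}{m}$ with $m\ge 0$ an integer are read as polynomials in $t$, namely $\frac{1}{m!}\prod_{i=0}^{m-1}(t+c-i)$. *)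

(* Defs.v *)
From HB Require Import structures.
From mathcomp Require Import all_boot all_order all_algebra.
From mathcomp Require Import all_classical all_reals all_analysis.

Set Implicit Arguments.
Unset Strict Implicit.
Unset Printing Implicit Defensive.

Import Order.TTheory GRing.Theory Num.Theory.

Local Open Scope ring_scope.

(* The ground set S is an explicit subset of a fixed type, so that the summands
   of a direct sum live over the same type as the sum itself. *)
Record matroid (E : finType) (S : {set E}) := Matroid {
  bases : {set {set E}};
  bases_sub : forall B, B \in bases -> B \subset S;
  bases_neq0 : bases != finset.set0;
  bases_exchange : forall A B, A \in bases -> B \in bases ->
    forall x, x \in A :\: B ->
    exists2 y, y \in B :\: A & y |: (A :\ x) \in bases
}.

Section MatroidTheory.
Variables (E : finType) (S : {set E}).
Implicit Types (M : matroid S) (A F : {set E}).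

(* The size of a largest independent subset of A, independent sets being the
   subsets of bases. *)
Definition mrank M A : nat := (\max_(B in bases M) #|A :&: B|)%N.

Definition rk M : nat := mrank M S.

Definition flat M F : bool :=
  (F \subset S) && [forall x in S :\: F, (mrank M F < mrank M (x |: F))%N].

(* Written without the truncated subtraction rk M - 1. *)
Definition hyperplane M F : bool := flat M F && ((mrank M F).+1 == rk M).

Definition hyperplanes M : {set {set E}} := finset (hyperplane M).

Definition direct_sum M (S1 S2 : {set E}) (M1 : matroid S1) (M2 : matroid S2)
    : Prop :=
  [/\ S1 :|: S2 = S, [disjoint S1 & S2]
    & bases M = [set B1 :|: B2 | B1 in bases M1, B2 in bases M2]%SET].

Definition connected_matroid M : Prop :=
  ~ exists (S1 S2 : {set E}) (M1 : matroid S1) (M2 : matroid S2),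
    [/\ S1 \proper S, S2 \proper S & direct_sum M M1 M2].

End MatroidTheory.

Local Open Scope classical_set_scope.

Definition convex_hull (R : realType) (n : nat) (A : set 'rV[R]_n)
    : set 'rV[R]_n :=
  smallest (@convex_set R 'rV[R]_n) A.

Definition indicator_row (R : realType) (n : nat) (B : {set 'I_n}) : 'rV[R]_n :=
  \row_i (i \in B)%:R.

Definition matroid_polytope (R : realType) (n : nat) (S : {set 'I_n})
    (M : matroid S) : set 'rV[R]_n :=
  convex_hull [set indicator_row R B | B in [set` bases M]].

Arguments matroid_polytope R {n S} M.

Definition lattice_points (R : realType) (n : nat) (P : set 'rV[R]_n) (t : nat)
    : set 'rV[R]_n :=
  [set t%:R *: x | x in P] `&` [set x | x \is a mxOver Num.int].

(* "p is the Ehrhart polynomial of P": p is determined by P, see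
   [is_ehrhart_poly_uniq]. *)
Definition is_ehrhart_poly (R : realType) (n : nat) (P : set 'rV[R]_n)
    (p : {poly rat}) : Prop :=
  forall t : nat,
    exists2 k : nat, (lattice_points P t #= `I_k)%card & p.[t%:R] = k%:R.

Lemma is_ehrhart_poly_uniq (R : realType) (n : nat) (P : set 'rV[R]_n)
    (p q : {poly rat}) :
  is_ehrhart_poly P p -> is_ehrhart_poly P q -> p = q.
Proof.
move=> hp hq; apply/eqP; rewrite -subr_eq0; apply/negPn/negP => pq0.
pose s := [seq (i%:R : rat) | i <- iota 0 (size (p - q)%R)].
have : (size s < size (p - q)%R)%N.
  apply: max_poly_roots => //.
    apply/allP => _ /mapP[t _ ->]; rewrite /root !hornerE.
    have [j Pj ->] := hp t; have [k Pk ->] := hq t.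
    have -> : j = k by apply/card_eq_II; exact: card_eq_trans (card_esym Pj) Pk.
    by rewrite subrr.
  by rewrite map_inj_uniq ?iota_uniq // => i j /eqP; rewrite eqr_nat => /eqP.
by rewrite size_map size_iota ltnn.
Qed.

(* The binomial coefficient "p choose m", for a polynomial p in t. *)
Definition poly_binom (p : {poly rat}) (m : nat) : {poly rat} :=
  (m`!%:R)^-1 *: \prod_(i < m) (p - i%:R).

(* The upper entries are computed in {poly rat} ('X is t); the lower ones are
   natural numbers, with no truncation when 1 <= k <= a <= n. *)
Definition P_poly (a n : nat) : {poly rat} :=
  \sum_(1 <= k < a.+1)
    poly_binom ('X + n%:R - k%:R - 1) (n - k)
      * poly_binom ('X + k%:R - 1) (k - 1).

(* Main.v *)
(* In a connected rank-2 matroid the hyperplanes are the parallel classes: they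
   partition the ground set, and the bases are the pairs meeting two classes.
   Hence the lattice points of tP are the x in N^n of sum 2t carrying at most t on
   each hyperplane; conversely such an x is a sum of t basis indicators, because
   one can always remove one element from each of two heaviest classes.

   Among all x of sum 2t, at most one class can carry more than t, so the bad
   vectors are subtracted class by class. For a class {1, ..., a}, the bad x are
   sorted by the first k with x_1 + ... + x_k > t: there are binom(t+k-1, k-1)
   choices of x_1, ..., x_(k-1) of sum at most t, and after removing the amount
   needed to exceed t the rest is any vector of N^(n-k+1) of sum t-1, which gives
   the k-th term of P_(a,n). *)
Require Import Defs.
From HB Require Import structures.
From mathcomp Require Import all_boot all_order all_algebra.
From mathcomp Require Import all_classical all_reals all_analysis.
From mathcomp Require Import zify.

Set Implicit Arguments.
Unset Strict Implicit.
Unset Printing Implicit Defensive.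

Import Order.TTheory GRing.Theory Num.Theory.

Local Open Scope ring_scope.

(** * Counting vectors of given sum by coefficients of generating functions *)

Lemma sum_bin_diag (m t : nat) :
  (\sum_(0 <= c < t) 'C(c + m, m))%N = 'C(t + m, m.+1).
Proof.
elim: t => [|t IH]; first by rewrite big_geq // add0n bin_small.
by rewrite big_nat_recr //= IH addSn binS addnC.
Qed.

(* With p = 2t - c, both sides sum u i * v c over the i <= p with p > t; the
   right-hand side splits according to i > t or i <= t. *)
Lemma box_sum_step (t : nat) (u v : nat -> int) :
  \sum_(t.+1 <= p < t.*2.+1) (\sum_(0 <= i < p.+1) u i) * v (t.*2 - p)%N
  = \sum_(t.+1 <= i < t.*2.+1) u i * (\sum_(0 <= c < (t.*2 - i).+1) v c)
    + (\sum_(0 <= i < t.+1) u i) * (\sum_(0 <= c < t) v c).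
Proof.
have rv i : (i <= t.*2)%N -> \sum_(0 <= c < (t.*2 - i).+1) v c
    = \sum_(i <= p < t.*2.+1) v (t.*2 - p)%N.
  move=> it; rewrite -[in RHS](add0n i) big_addn subSn // big_nat_rev /=.
  rewrite add0n; apply: eq_big_nat => c /= ct.
  by congr v; rewrite subSS -subnDA addnC.
have -> : \sum_(0 <= c < t) v c = \sum_(t.+1 <= p < t.*2.+1) v (t.*2 - p)%N.
  (* The instance [i = t + 1] of [rv] requires [t + 1 <= 2t], so [t = 0] is treated apart. *)
  case: t rv => [|t] rv; first by rewrite !big_geq.
  rewrite -rv; last by rewrite -addnn addSn ltnS leq_addl.
  by rewrite (_ : (t.+1.*2 - t.+2).+1 = t.+1)%N // -addnn addSn addnS !subSS addnK.
rewrite mulr_sumr.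
have -> : \sum_(t.+1 <= i < t.*2.+1) u i * (\sum_(0 <= c < (t.*2 - i).+1) v c)
   = \sum_(t.+1 <= p < t.*2.+1) \sum_(t.+1 <= i < p.+1) u i * v (t.*2 - p)%N.
  transitivity (\sum_(t.+1 <= i < t.*2.+1)
     \sum_(t.+1 <= p < t.*2.+1 | (i <= p)%N) u i * v (t.*2 - p)%N).
    apply: eq_big_nat => i /andP[ti it].
    by rewrite rv ?(ltnSE it) // mulr_sumr (big_nat_widenl _ t.+1) //; apply: eq_bigl.
  rewrite (exchange_big_dep_nat xpredT) //=.
  apply: eq_big_nat => p /andP[tp pt].
  by rewrite [RHS](big_nat_widen _ _ t.*2.+1).
rewrite -big_split /=; apply: eq_big_nat => p /andP[tp pt].
rewrite -mulr_suml -mulrDl addrC; congr (_ * _).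
by rewrite [LHS](big_cat_nat (n := t.+1)) // ltnW // ltnS.
Qed.

(** The geometric series [1 / (1 - X)] truncated at degree [D]. Its powers agree with those of the
    full series up to degree [D], while entries bounded by [D] range over a finite type. *)
Definition box_poly (D : nat) : {poly int} := \poly_(i < D.+1) 1.

(** Multiplying by the geometric series takes partial sums of coefficients; the truncation is not
    felt up to degree [D]. *)
Lemma coef_box_polyXS (D m j : nat) : (j <= D)%N ->
  (box_poly D ^+ m.+1)`_j = \sum_(0 <= i < j.+1) (box_poly D ^+ m)`_i.
Proof.
move=> jD; rewrite exprSr coefM big_mkord; apply: eq_bigr => i _.
by rewrite coef_poly ltnS (leq_trans (leq_subr _ _) jD) mulr1.
Qed.

Lemma coef_box_polyX (D m j : nat) : (j <= D)%N ->
  (box_poly D ^+ m.+1)`_j = 'C(j + m, m)%:R.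
Proof.
elim: m j => [|m IH] j jD; first by rewrite expr1 coef_poly ltnS jD bin0.
rewrite coef_box_polyXS // -addSnnS -sum_bin_diag natr_sum.
by apply: eq_big_nat => i /andP[_ ij]; rewrite IH // (leq_trans _ jD).
Qed.

(* Both sides are coefficients of the generating function in two variables, one
   marking the sum over A and one the sum over ~: A. *)
Lemma card_ffun_two_sums (I : finType) (A : {set I}) (D p q : nat) :
  #|[set f : {ffun I -> 'I_D.+1} | (\sum_(i in A) f i == p)%N
                                   && (\sum_(i in ~: A) f i == q)%N]|%:R
  = (box_poly D ^+ #|A|)`_p * (box_poly D ^+ #|~: A|)`_q.
Proof.
(* The outer variable marks the elements of [A]; the inner one, living in the coefficient ring,
   marks those outside [A]. *)
pose F (i : I) (j : 'I_D.+1) : {poly {poly int}} :=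
  if i \in A then 'X^j else ('X^j)%:P.
have boxE (R : nzRingType) : \poly_(i < D.+1) 1 = \sum_(j < D.+1) 'X^j :> {poly R}.
  by rewrite poly_def; apply: eq_bigr => j _; rewrite scale1r.
have L : \prod_i \sum_j F i j
    = (box_poly D ^+ #|A|)^:P * (box_poly D ^+ #|~: A|)%:P.
  rewrite (bigID (mem A)) /=; congr (_ * _).
    rewrite rmorphXn /= -prodr_const; apply: eq_bigr => i iA.
    rewrite /F iA /box_poly boxE rmorph_sum /=.
    by apply: eq_bigr => j _; rewrite rmorphXn /= map_polyX.
  rewrite rmorphXn /= -prodr_const.
  under eq_bigl do rewrite -finset.in_setC.
  apply: eq_bigr => i; rewrite inE => /negPf iA.
  by rewrite /F iA /box_poly boxE rmorph_sum.
have Rf (f : {ffun I -> 'I_D.+1}) : \prod_i F i (f i)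
    = 'X^(\sum_(i in A) f i) * ('X^(\sum_(i in ~: A) f i))%:P.
  rewrite (bigID (mem A)) /=; congr (_ * _).
    by rewrite -prodrXr; apply: eq_bigr => i iA; rewrite /F iA.
  rewrite -prodrXr rmorph_prod /=.
  under eq_bigl do rewrite -finset.in_setC.
  by apply: eq_bigr => i; rewrite inE => /negPf iA; rewrite /F iA.
have := congr1 (fun P : {poly {poly int}} => P`_p`_q) L.
rewrite coefMC coef_map /= coefCM => <-.
rewrite bigA_distr_bigA /= -sum1_card natr_sum big_mkcond /=.
rewrite !coef_sum; apply: eq_bigr => f _.
rewrite Rf coefMC coefXn inE (eq_sym p).
case: (_ == p); last by rewrite mul0r coef0.
by rewrite mul1r coefXn (eq_sym q) /=; case: (_ == q).
Qed.

(** Stars and bars: the bound [D] on each entry is automatic when the total is [D]. This is the case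
    of two sums where the complement is empty. *)
Lemma card_ffun_sum (I : finType) (D : nat) : (0 < #|I|)%N ->
  #|[set f : {ffun I -> 'I_D.+1} | (\sum_i f i == D)%N]|
  = 'C(D + #|I|.-1, #|I|.-1).
Proof.
move=> I0; apply/eqP; rewrite -(eqr_nat int); apply/eqP.
have := card_ffun_two_sums [set: I] D D 0.
rewrite finset.setCT cards0 expr0 coef1 mulr1 cardsT -{1}(prednK I0) coef_box_polyX //.
move=> <-; congr (_%:R); apply: eq_card => f; rewrite !inE.
rewrite [X in _ = (_ == _) && (X == _)]big_pred0 ?andbT //; last by move=> i; rewrite inE.
by congr (_ == _); apply: eq_bigl => i; rewrite inE.
Qed.

(* The k-th term counts the f whose partial sums, in an enumeration of A,
   first exceed t at the k-th element. *)
Lemma card_ffun_sum_gt (I : finType) (A : {set I}) (t : nat) : (#|A| < #|I|)%N ->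
  #|[set f : {ffun I -> 'I_t.*2.+1} | (\sum_i f i == t.*2)%N
                                      && (t < \sum_(i in A) f i)%N]|
  = (\sum_(1 <= k < #|A|.+1)
      'C(t + (#|I| - k).-1, #|I| - k) * 'C(t + k.-1, k.-1))%N.
Proof.
move=> AI; pose w m j := (box_poly t.*2 ^+ m)`_j.
have tt : (t <= t.*2)%N by rewrite -addnn leq_addr.
(* Here [w m j] counts the vectors with [m] entries and sum [j]. By [box_sum_step], moving one more
   coordinate into the first block adds exactly the term [k = a + 1]. *)
have tele a : (a <= #|I|)%N ->
    \sum_(t.+1 <= p < t.*2.+1) w a p * w (#|I| - a)%N (t.*2 - p)%N
    = \sum_(1 <= k < a.+1) w k t * \sum_(0 <= c < t) w (#|I| - k)%N c.
  elim: a => [|a IH] aI.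
    rewrite [RHS]big_geq // big_nat big1 // => p /andP[tp _].
    by rewrite /w expr0 coef1; case: p tp => // p _; rewrite mul0r.
  have w_step m j : (j <= t.*2)%N -> w m.+1 j = \sum_(0 <= i < j.+1) w m i.
    exact: coef_box_polyXS.
  rewrite [RHS]big_nat_recr //= -IH ?(ltnW aI) // w_step // -(subnSK aI).
  have -> : \sum_(t.+1 <= p < t.*2.+1) w a p * w (#|I| - a.+1).+1 (t.*2 - p)%N
      = \sum_(t.+1 <= p < t.*2.+1)
          w a p * \sum_(0 <= c < (t.*2 - p).+1) w (#|I| - a.+1)%N c.
    by apply: eq_big_nat => p _; rewrite w_step // leq_subr.
  rewrite -box_sum_step; apply: eq_big_nat => p /andP[_ pt].
  by rewrite w_step.
apply/eqP; rewrite -(eqr_nat int); apply/eqP.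
(* Sort the vectors by their sum [p] over [A], where [t < p <= 2t]. *)
transitivity (\sum_(t.+1 <= p < t.*2.+1)
    w #|A| p * w (#|I| - #|A|)%N (t.*2 - p)%N); last first.
  rewrite tele ?(ltnW AI) // natr_sum; apply: eq_big_nat => k /andP[k0 kA].
  have kI : (k < #|I|)%N by rewrite (leq_ltn_trans _ AI).
  rewrite natrM mulrC; congr (_ * _).
    (* Summing over totals [c < t] is the hockey-stick identity; it applies because [#|I| - k] is
       positive, which comes from [#|A| < #|I|]. *)
    rewrite -subn_gt0 in kI; rewrite -[in RHS](prednK kI) /= -sum_bin_diag natr_sum.
    apply: eq_big_nat => c /andP[_ ct].
    by rewrite /w -(prednK kI) coef_box_polyX // (leq_trans (ltnW ct)).
  by rewrite /w -{1}(prednK k0) coef_box_polyX.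
have -> : (#|I| - #|A|)%N = #|~: A| by rewrite -(cardsC A) addKn.
under eq_bigr do rewrite /w -card_ffun_two_sums.
under eq_bigr do rewrite -sum1_card natr_sum big_mkcond /=.
rewrite exchange_big /= -sum1_card natr_sum big_mkcond /=.
apply: eq_bigr => f _; rewrite inE.
have -> : (\sum_i f i = \sum_(i in A) f i + \sum_(i in ~: A) f i)%N.
  rewrite (bigID (mem A)) /=; congr (_ + _)%N.
  by apply: eq_bigl => i; rewrite inE.
set p := (\sum_(i in A) f i)%N; set q := (\sum_(i in ~: A) f i)%N.
under eq_bigr do rewrite inE.
have [|] := boolP [&& (p + q == t.*2)%N & (t < p)%N].
  case/andP=> /eqP pq tp.
  (* For a fixed [f], the only index that contributes is its own sum over [A]. *)
  rewrite (big_rem p) /=; last first.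
    by rewrite mem_index_iota tp ltnS -pq leq_addr.
  rewrite (_ : (t.*2 - p)%N = q) ?eqxx; last by rewrite -pq addKn.
  rewrite /= big_seq big1 ?addr0 // => r.
  rewrite mem_rem_uniq ?iota_uniq // inE eq_sym.
  by case/andP=> /negPf ->.
move=> pqt; rewrite big_seq big1 // => r.
rewrite mem_index_iota => /andP[tr rt].
case: ifP => // /andP[/eqP pr /eqP qr]; case/negP: pqt.
by rewrite /p /q pr qr subnKC // eqxx.
Qed.

(** * Values of the binomial polynomials at natural numbers, and the count class by class *)

Lemma horner_natr (R : nzSemiRingType) (n : nat) (x : R) :
  (n%:R : {poly R}).[x] = n%:R.
Proof. by rewrite -polyC_natr hornerC. Qed.

Lemma horner_poly_binom (p : {poly rat}) (m N t : nat) :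
  p.[t%:R] = N%:R -> (poly_binom p m).[t%:R] = 'C(N, m)%:R.
Proof.
move=> pN; rewrite hornerZ horner_prod.
have -> : \prod_(i < m) (p - i%:R).[t%:R] = (N ^_ m)%:R :> rat.
  elim: m => [|m IH]; first by rewrite big_ord0.
  rewrite big_ord_recr /= IH ffactnSr natrM !hornerE horner_natr pN.
  (* For [N < m] the subtraction [N - m] truncates, but the falling factorial [N ^_ m] already
     vanishes. *)
  have [mN|Nm] := leqP m N; first by rewrite natrB.
  by rewrite ffact_small // !mul0r.
rewrite -bin_ffact natrM mulrCA mulVf ?mulr1 //.
Qed.

(** The hypothesis [a < n] keeps [n - k] positive, so that the truncated [(n - k).-1] equals the
    upper offset [n - k - 1] of the polynomial. *)
Lemma horner_P_poly (a n t : nat) : (a < n)%N ->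
  (P_poly a n).[t%:R] =
  (\sum_(1 <= k < a.+1)
     'C(t + (n - k).-1, n - k) * 'C(t + k.-1, k.-1))%N%:R.
Proof.
move=> an; rewrite horner_sum natr_sum; apply: eq_big_nat => k /andP[k0 ka].
have kn : (k < n)%N by rewrite (leq_trans ka).
rewrite hornerM natrM; congr (_ * _); last first.
  rewrite subn1; apply: horner_poly_binom.
  by rewrite !hornerE horner_natr -{1}(prednK k0) -natr1 addrA addrK natrD.
apply: horner_poly_binom.
rewrite !hornerE !horner_natr natrD -addrA -addrA; congr (_ + _).
have nk0 : (0 < n - k)%N by rewrite subn_gt0.
by rewrite addrA -natrB ?(ltnW kn) // -{1}(prednK nk0) -natr1 addrK.
Qed.

(* At most one class can carry more than half of the total 2t. *)
Lemma card_ffun_classes_le (I : finType) (s : nat) (cls : I -> 'I_s) (t : nat) :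
  (#|[set f : {ffun I -> 'I_t.*2.+1} | (\sum_i f i == t.*2)%N
       && [forall h, \sum_(i | cls i == h) f i <= t]%N]|
   + \sum_h #|[set f : {ffun I -> 'I_t.*2.+1} | (\sum_i f i == t.*2)%N
       && (t < \sum_(i in [set i | cls i == h]%SET) f i)%N]|
   = #|[set f : {ffun I -> 'I_t.*2.+1} | (\sum_i f i == t.*2)%N]|)%N.
Proof.
(* After interchanging the sums, it remains to see that each [f] of total [2t] is counted exactly
   once. *)
under [X in (_ + X)%N]eq_bigr do rewrite -sum1_card big_mkcond /=.
rewrite exchange_big /= -!sum1_card !(big_mkcond (fun f => f \in _)) /= -big_split.
apply: eq_bigr => f _ /=; rewrite !inE.
under [X in (_ + X)%N]eq_bigr => h _.
  rewrite inE [X in (t < X)%N](eq_bigl (fun i => cls i == h)); last by move=> i; rewrite inE.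
  over.
have [ft|nft] := eqVneq; last by rewrite /= big1_eq.
rewrite /=; case: ifP => [/forallP le|/negbT/forallPn[h0]].
  by rewrite big1 // => h _; rewrite ltnNge le.
rewrite -ltnNge => h0t.
rewrite (bigD1 h0) //= h0t big1 // => h hh0; case: ifP => // ht.
suff : (t.+1 + t.+1 <= t.*2)%N by rewrite addSn addnS addnn ltnNge leqnSn.
rewrite -[leqRHS]ft (bigID (fun i => cls i == h0)) /= leq_add //.
rewrite (leq_trans ht) // [leqRHS](bigID (fun i => cls i == h)) /=.
apply: leq_trans (leq_addr _ _); apply: eq_leq; apply: eq_bigl => i.
by case: (eqVneq (cls i) h) => [->|]; rewrite ?andbT ?andbF.
Qed.

(** * Bases of a matroid, and rank-one uniform matroids *)

Section MatroidBases.
Variables (E : finType) (S : {set E}) (M : matroid S).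

(** An exchange swaps an element of [A] outside [B] for one of [B], keeping [#|A|] and shrinking
    [A :\: B]. Once [A] lies in [B], an element of [B :\: A] would have nothing to be exchanged
    with. *)
Lemma card_bases (A B : {set E}) : A \in bases M -> B \in bases M -> #|A| = #|B|.
Proof.
move: {2}_.+1 (ltnSn #|A :\: B|) => k; elim: k A => // k IH A ABk hA hB.
have [AB0|[x xAB]] := set_0Vmem (A :\: B).
  have AB : A \subset B by rewrite -finset.setD_eq0 AB0.
  suff -> : A = B by [].
  apply/eqP; rewrite finset.eqEsubset AB /= -finset.setD_eq0; apply/eqP.
  have [//|[x xBA]] := set_0Vmem (B :\: A).
  by have [y] := bases_exchange hB hA xBA; rewrite AB0 inE.
have [y yBA hA'] := bases_exchange hA hB xAB.
move: (xAB) (yBA); rewrite !inE => /andP[xB xA] /andP[yA yB].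
rewrite -(IH (y |: (A :\ x))) //.
  by rewrite cardsU1 !inE (negPf yA) andbF (cardsD1 x A) xA.
rewrite -ltnS; apply: leq_trans ABk; rewrite ltnS; apply: proper_card.
apply/properP; split; last by exists x; rewrite // !inE eqxx orbF;
  case: (eqVneq x y) xB => [->|]; rewrite ?yB ?andbF.
apply/fintype.subsetP => z; rewrite !inE => /andP[zB /orP[/eqP zy|/andP[_ ->]]].
  by rewrite zy yB in zB.
by rewrite zB.
Qed.

Definition uniform1_bases (T : {set E}) : {set {set E}} := [set [set i]%SET | i in T]%SET.

(** Two such matroids will be the direct summands of a rank-two matroid with only two parallel
    classes. *)
Lemma uniform1_matroid (T : {set E}) : T != finset.set0 ->
  exists N : matroid T, bases N = uniform1_bases T.
Proof.
move=> T0.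
have sub B : B \in uniform1_bases T -> B \subset T.
  by case/imsetP => i iT ->; rewrite finset.sub1set.
have ne0 : uniform1_bases T != finset.set0.
  have /set0Pn[i iT] := T0; apply/set0Pn; exists [set i]%SET.
  exact: imset_f.
have exch A B : A \in uniform1_bases T -> B \in uniform1_bases T ->
    forall x, x \in A :\: B ->
    exists2 y, y \in B :\: A & y |: (A :\ x) \in uniform1_bases T.
  case/imsetP => i iT -> /imsetP[j jT ->] x; rewrite !inE => /andP[xj /eqP xi].
  subst x; exists j; first by rewrite !inE eqxx eq_sym xj.
  by rewrite finset.setDv finset.setU0; exact: imset_f.
by exists (Matroid sub ne0 exch).
Qed.

End MatroidBases.

(** * Connected matroids of rank two: hyperplanes as parallel classes *)

Section RankTwo.
Variables (E : finType) (M : matroid [set: E]%SET).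
Hypotheses (hconn : connected_matroid M) (hrk : rk M = 2%N).

Lemma card_base2 (B : {set E}) : B \in bases M -> #|B| = 2%N.
Proof.
move=> hB; rewrite -hrk /rk /mrank.
have bases0 : (0 < #|bases M|)%N by rewrite card_gt0 bases_neq0.
have [A hA ->] := eq_bigmax_cond (fun A => #|[set: E]%SET :&: A|) bases0.
rewrite finset.setTI; exact: card_bases hB hA.
Qed.

Lemma base2P (B : {set E}) : B \in bases M ->
  exists x y, [/\ x != y & B = [set x; y]%SET].
Proof. by move=> /card_base2/eqP/cards2P[x] [y] [xy ->]; exists x, y. Qed.

(** A loop [x] would split off as a rank-zero summand on [{x}], the other summand having the same
    bases on the complement. *)
Lemma loopless (x : E) : exists2 B, B \in bases M & x \in B.
Proof.
apply: contrapT => nx; apply: hconn.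
have nxB B : B \in bases M -> x \notin B.
  by move=> hB; apply/negP => xB; apply: nx; exists B.
have sub1 B : B \in [set finset.set0]%SET -> B \subset [set x]%SET.
  by move=> /set1P ->; exact: finset.sub0set.
have ne1 : [set finset.set0]%SET != finset.set0 :> {set {set E}}.
  by apply/set0Pn; exists finset.set0; rewrite inE.
have ex1 (A B : {set E}) : A \in [set finset.set0]%SET -> B \in [set finset.set0]%SET ->
    forall z, z \in A :\: B ->
    exists2 y, y \in B :\: A & y |: (A :\ z) \in [set finset.set0]%SET.
  by move=> /set1P -> _ z; rewrite !inE andbF.
have sub2 B : B \in bases M -> B \subset [set~ x]%SET.
  by move=> /nxB xB; rewrite finset.subsetC finset.sub1set inE.
exists [set x]%SET, [set~ x]%SET, (Matroid sub1 ne1 ex1),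
  (Matroid sub2 (bases_neq0 M) (@bases_exchange _ _ M)).
have /set0Pn[B hB] := bases_neq0 M.
have [u [v [uv BE]]] := base2P hB.
split; last split => /=.
- rewrite properE finset.subsetT /=; apply/negP => /fintype.subsetP sx.
  have /set1P ux := sx u (finset.in_setT _); have /set1P vx := sx v (finset.in_setT _).
  by rewrite ux vx eqxx in uv.
- by rewrite properE finset.subsetT /=; apply/negP => /fintype.subsetP/(_ x (finset.in_setT _));
  rewrite !inE eqxx.
- exact: finset.setUCr.
- by rewrite -setI_eq0 finset.setICr.
- apply/finset.setP => C; apply/idP/imset2P => [hC|[C1 C2 /set1P -> hC2 ->]].
    by exists finset.set0 C; rewrite ?inE // finset.set0U.
  by rewrite finset.set0U.
Qed.

(* Nonloops x and y are parallel; in rank 2 they then span the same hyperplane. *)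
Definition parallel (x y : E) : bool := [set x; y]%SET \notin bases M.

Lemma parallelxx x : parallel x x.
Proof. by apply/negP => /card_base2; rewrite finset.setUid cards1. Qed.

Lemma parallel_sym x y : parallel x y = parallel y x.
Proof. by rewrite /parallel finset.setUC. Qed.

(** Looplessness puts [y] in a basis [{y, l}]. If [{x, z}] were a basis, exchanging [l] against it
    would pair [y] with [x] or [z]. *)
Lemma parallel_trans x y z : parallel x y -> parallel y z -> parallel x z.
Proof.
move=> xy yz; apply/negP => xz.
have [B hB yB] := loopless y.
have [l [yl BE]] : exists l, y != l /\ B = [set y; l]%SET.
  have [u [v [uv BE]]] := base2P hB; move: yB; rewrite BE !inE => /orP[]/eqP ->.
    by exists v.
  by exists u; rewrite eq_sym finset.setUC.
rewrite {B yB}BE in hB.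
have lxz : l \in [set y; l]%SET :\: [set x; z]%SET.
  rewrite !inE eqxx orbT andbT; apply/negP => /orP[]/eqP lE; rewrite lE in hB.
    by rewrite parallel_sym /parallel hB in xy.
  by rewrite /parallel hB in yz.
have [w] := bases_exchange hB xz lxz; rewrite !inE => /andP[_ wE].
have -> : w |: ([set y; l] :\ l) = [set w; y]%SET.
  apply/finset.setP => e; rewrite !inE; case: (eqVneq e l) => //= [->|].
    by rewrite (negPf (_ : l != y)) // eq_sym.
  by rewrite orbF.
by case/orP: wE => /eqP ->; apply/negP; rewrite -/(parallel _ _) // parallel_sym.
Qed.

Lemma leq_mrank (F B : {set E}) : B \in bases M -> (#|F :&: B| <= mrank M F)%N.
Proof.
by move=> hB; exact: (@leq_bigmax_cond _ (mem (bases M)) (fun B => #|F :&: B|)).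
Qed.

Lemma mrank_gt1P (F : {set E}) :
  reflect (exists2 B, B \in bases M & B \subset F) (1 < mrank M F)%N.
Proof.
apply: (iffP idP) => [|[B hB BF]].
  have bases0 : (0 < #|bases M|)%N by rewrite card_gt0 bases_neq0.
  have [B hB] := eq_bigmax_cond (fun B => #|F :&: B|) bases0.
  rewrite /mrank => -> FB.
  exists B => //; apply/finset.setIidPr/eqP.
  by rewrite eqEcard finset.subsetIr card_base2.
apply: (@leq_trans #|F :&: B|); first by rewrite (finset.setIidPr BF) card_base2.
exact: leq_mrank.
Qed.

Lemma mrank_gt0 (F : {set E}) x : x \in F -> (0 < mrank M F)%N.
Proof.
move=> xF; have [B hB xB] := loopless x.
apply: (@leq_trans #|F :&: B|); last exact: leq_mrank.
by rewrite card_gt0; apply/set0Pn; exists x; rewrite inE xF.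
Qed.

(** Rank one makes the elements of [F] pairwise parallel. If [y] outside [F] were parallel to [x],
    flatness would give a basis inside [y |: F], yet all elements of that set are parallel to
    [y]. *)
Lemma hyperplane_parallel (F : {set E}) x : F \in hyperplanes M -> x \in F ->
  F = [set y | parallel x y]%SET.
Proof.
rewrite inE /hyperplane hrk eqSS => /andP[/andP[_ /forallP flatF] /eqP rF] xF.
have parF u v : u \in F -> v \in F -> parallel u v.
  move=> uF vF; apply/negP => huv; have : (1 < mrank M F)%N.
    by apply/mrank_gt1P; exists [set u; v]%SET; rewrite // finset.subUset !finset.sub1set uF.
  by rewrite rF.
apply/finset.setP => y; rewrite inE; apply/idP/idP => [|xy]; first exact: parF.
apply: contraT => yF; move: (flatF y); rewrite !inE yF /= rF.
move=> /mrank_gt1P[B hB BF].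
have yB : y \in B.
  apply: contraT => yB; have : (1 < mrank M F)%N; last by rewrite rF.
  apply/mrank_gt1P; exists B => //; apply/fintype.subsetP => z zB.
  have := fintype.subsetP BF z zB; rewrite !inE => /orP[/eqP zy|//].
  by rewrite -zy zB in yB.
have parB v : v \in B -> parallel y v.
  move=> /(fintype.subsetP BF); rewrite !inE => /orP[/eqP ->|vF].
    exact: parallelxx.
  by apply: (@parallel_trans _ x); rewrite 1?parallel_sym // parF.
have [u [v [uv BE]]] := base2P hB.
suff : B \notin bases M by rewrite hB.
rewrite BE -/(parallel u v).
have uB : u \in B by rewrite BE !inE eqxx.
have vB : v \in B by rewrite BE !inE eqxx orbT.
by apply: (@parallel_trans _ y); [rewrite parallel_sym|]; exact: parB.
Qed.

Lemma parallel_hyperplane x : [set y | parallel x y]%SET \in hyperplanes M.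
Proof.
set C := finset _; have xC : x \in C by rewrite inE parallelxx.
have rC : mrank M C = 1%N.
  apply/eqP; rewrite eqn_leq (mrank_gt0 xC) andbT leqNgt.
  apply/mrank_gt1P => -[B hB BC]; have [u [v [uv BE]]] := base2P hB.
  move: BC hB; rewrite BE finset.subUset !finset.sub1set !inE => /andP[xu xv].
  by apply/negP; apply: (@parallel_trans _ x); rewrite // parallel_sym.
rewrite inE /hyperplane hrk rC eqxx andbT /flat finset.subsetT /=.
apply/forallP => y; apply/implyP; rewrite !inE andbT negbK => xy; rewrite rC.
apply/mrank_gt1P; exists [set x; y]%SET => //.
by rewrite finset.subUset !finset.sub1set !inE parallelxx eqxx orbT.
Qed.

Variables (s : nat) (H : 'I_s -> {set E}).
Hypotheses (hinj : injective H) (hH : [set H i | i : 'I_s]%SET = hyperplanes M).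

(** The map [cls] sends an element to the index of its parallel class. With at most two classes the
    bases would be all pairs with one element from each, a direct sum of two rank-one matroids,
    against connectedness. *)
Lemma hyperplane_classes : exists cls : E -> 'I_s,
  [/\ forall h, H h = [set x | cls x == h]%SET,
      forall x y, ([set x; y]%SET \in bases M) = (cls x != cls y)
    & (2 < s)%N].
Proof.
have [|cls clsE] := @fin_all_exists E (fun=> 'I_s)
  (fun x h => H h = [set y | parallel x y]%SET).
  move=> x; have := parallel_hyperplane x; rewrite -hH => /imsetP[h _ ->].
  by exists h.
have cls_par x y : (cls x == cls y) = parallel x y.
  apply/eqP/idP => [xy|xy].
    by have := clsE x; rewrite xy clsE => /finset.setP/(_ y); rewrite !inE parallelxx.
  apply: hinj; rewrite !clsE; apply/finset.setP => z; rewrite !inE.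
  apply/idP/idP; apply: parallel_trans => //; by rewrite parallel_sym.
have HE h : H h = [set x | cls x == h]%SET.
  have hM : H h \in hyperplanes M by rewrite -hH; exact: imset_f.
  have [/eqP|[x xh]] := set_0Vmem (H h).
    move: hM; rewrite inE /hyperplane hrk eqSS => /andP[_ /eqP rh] /eqP h0.
    move: rh; rewrite h0 /mrank big1 // => B _.
    by rewrite finset.set0I cards0.
  have hx : cls x = h by apply: hinj; rewrite clsE (hyperplane_parallel hM xh).
  rewrite (hyperplane_parallel hM xh); apply/finset.setP => y.
  by rewrite !inE -cls_par hx eq_sym.
have basesE x y : ([set x; y]%SET \in bases M) = (cls x != cls y).
  by rewrite cls_par negbK.
exists cls; split => //; rewrite ltnNge; apply/negP => s2; apply: hconn.
have /set0Pn[B hB] := bases_neq0 M.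
have [u [v [uv BE]]] := base2P hB; rewrite {B}BE basesE in hB.
(* With at most two classes, each element lies in exactly one of the classes of [u] and [v]. *)
have clsuv x : (cls x == cls u) (+) (cls x == cls v).
  case: (eqVneq (cls x) (cls u)) hB => [->|xu hB]; first by move=> /negPf ->.
  rewrite addFb; apply: contraLR s2 => xv; rewrite -ltnNge -[s in leqRHS]card_ord.
  have /card_uniqP uniq3 : uniq [:: cls x; cls u; cls v].
    by rewrite /= !inE negb_or xu xv hB.
  by apply: leq_trans (max_card (mem [:: cls x; cls u; cls v])); rewrite uniq3.
have clsu0 : [set x | cls x == cls u]%SET != finset.set0.
  by apply/set0Pn; exists u; rewrite inE.
have clsv0 : [set x | cls x == cls v]%SET != finset.set0.
  by apply/set0Pn; exists v; rewrite inE.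
have [M1 M1E] := uniform1_matroid clsu0.
have [M2 M2E] := uniform1_matroid clsv0.
exists _, _, M1, M2; split; last split.
- rewrite properE finset.subsetT; apply/negP => /fintype.subsetP/(_ v (finset.in_setT _)).
  by rewrite inE eq_sym (negPf hB).
- rewrite properE finset.subsetT; apply/negP => /fintype.subsetP/(_ u (finset.in_setT _)).
  by rewrite inE (negPf hB).
- by apply/finset.setP => x; rewrite !inE; case: eqP (clsuv x) => //= _ ->.
- rewrite -setI_eq0; apply/eqP/finset.setP => x; rewrite !inE.
  by case: eqP (clsuv x) => //= _; case: eqP.
apply/finset.setP => B; rewrite M1E M2E; apply/idP/imset2P; last first.
  case=> _ _ /imsetP[x + ->] /imsetP[y + ->] ->; rewrite !inE basesE.
  by move=> /eqP -> /eqP ->.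
move=> hB'; have [x [y [_ BE]]] := base2P hB'.
move: hB'; rewrite {B}BE basesE => xy.
case: (eqVneq (cls x) (cls u)) => xu.
  exists [set x]%SET [set y]%SET => //; apply: imset_f; rewrite inE ?xu //.
  by move: (clsuv y); rewrite -xu (eq_sym (cls y)) (negPf xy).
have yu : cls y == cls u.
  move: (clsuv x) (clsuv y); rewrite (negPf xu) /= => /eqP xv.
  by rewrite -xv [_ == cls x]eq_sym (negPf xy) addbF.
exists [set y]%SET [set x]%SET; last exact: finset.setUC.
  by apply: imset_f; rewrite inE.
by apply: imset_f; rewrite inE; move: (clsuv x); rewrite (negPf xu).
Qed.

End RankTwo.

(** * Splitting a basis off a vector of natural numbers *)

Lemma sum_gt0_ex (I : finType) (P : pred I) (F : I -> nat) :
  (0 < \sum_(i | P i) F i)%N -> exists2 i, P i & (0 < F i)%N.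
Proof.
rewrite lt0n sum_nat_eq0 => /forallPn[i]; rewrite negb_imply -lt0n.
by case/andP; exists i.
Qed.

(* Taking one element from each of two heaviest classes leaves no class with
   more than half of the remaining sum. *)
Lemma remove_pair (I : finType) (s : nat) (cls : I -> 'I_s) (t : nat) (f : I -> nat) :
  (\sum_i f i = t.+1.*2)%N -> (forall h, \sum_(i | cls i == h) f i <= t.+1)%N ->
  exists u v (f' : I -> nat),
    [/\ cls u != cls v, forall i, f i = (f' i + (i \in [set u; v]%SET))%N,
        (\sum_i f' i = t.*2)%N & forall h, (\sum_(i | cls i == h) f' i <= t)%N].
Proof.
move=> sumf f_le; pose S h := (\sum_(i | cls i == h) f i)%N.
have sumS : (\sum_h S h = t.+1.*2)%N.
  by rewrite -sumf (partition_big cls xpredT).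
have [i0 _ _] : exists2 i, xpredT i & (0 < f i)%N by apply: sum_gt0_ex; rewrite sumf.
case: (@arg_maxnP _ (cls i0) xpredT S isT) => h1 _ h1max.
(* A second nonempty class exists because the heaviest one carries at most [t + 1] of the total
   [2t + 2]. *)
have [h0 h01 h0gt] : exists2 h, h != h1 & (0 < S h)%N.
  apply: sum_gt0_ex; have := sumS; rewrite (bigD1 h1) //=; have := f_le h1.
  by rewrite -/(S h1) -addnn; lia.
case: (@arg_maxnP _ h0 (fun h => h != h1) S h01) => h2 h21 h2max.
have S2 : (0 < S h2)%N by exact: leq_trans h0gt (h2max _ h01).
have S1 : (0 < S h1)%N by exact: leq_trans S2 (h1max _ isT).
have [u /eqP uh1 fu] := sum_gt0_ex S1; have [v /eqP vh2 fv] := sum_gt0_ex S2.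
have uv : u != v by apply: contraNneq h21 => uv; rewrite -vh2 -uh1 uv.
pose f' i := (f i - (i \in [set u; v]%SET))%N.
have f'E i : f i = (f' i + (i \in [set u; v]%SET))%N.
  by rewrite subnK // !inE; case: eqP => [->//|_]; case: eqP => [->|].
have uvE i : (i \in [set u; v]%SET : nat) = ((i == u) + (i == v))%N.
  by rewrite !inE; case: (eqVneq i u) => [->|//]; rewrite (negPf uv).
have sum1 (P : pred I) w : (\sum_(i | P i) (i == w) = P w)%N.
  rewrite big_mkcond (bigD1 w) //= eqxx big1 ?addn0; first by case: (P w).
  by move=> i /negPf ->; case: ifP.
have sum_f'E (P : pred I) :
    (\sum_(i | P i) f i = \sum_(i | P i) f' i + (P u + P v))%N.
  rewrite (eq_bigr _ (fun i _ => f'E i)) big_split /=; congr (_ + _)%N.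
  by under eq_bigr do rewrite uvE; rewrite big_split /= !sum1.
have SE h : S h = (\sum_(i | cls i == h) f' i + ((h1 == h) + (h2 == h)))%N.
  by rewrite /S sum_f'E uh1 vh2.
exists u, v, f'; split => //; first by rewrite uh1 vh2 eq_sym.
  by move: (sum_f'E xpredT); rewrite sumf /=; lia.
move=> h; have := SE h; have := f_le h; rewrite -/(S h).
have [<-|hh1] := eqVneq h1 h; first by move=> ? ?; lia.
have [<-|hh2] := eqVneq h2 h; first by move=> ? ?; lia.
(* If a third class carried more than [t], so would the two heaviest, and the total would be at
   least [3(t + 1)]. *)
rewrite addn0 => _ <-; rewrite leqNgt; apply/negP => ht.
have : (S h1 + (S h2 + S h) <= t.+1.*2)%N.
  rewrite -sumS (bigD1 h1) //= leq_add2l (bigD1 h2) //= leq_add2l.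
  by rewrite (bigD1 h) ?leq_addr //= eq_sym hh1 eq_sym.
have := h1max h isT; have := h2max h; rewrite eq_sym hh1 => /(_ isT).
by rewrite -addnn; lia.
Qed.

Lemma convex_lmodE (R : realType) (V : lmodType R) (l : {i01 R}) (x y : convex_lmodType V) :
  conv l x y = l%:num *: (x : V) + (1 - l%:num) *: (y : V).
Proof. by []. Qed.

(** * The polytope, its inequalities and its lattice points *)

Section Polytope.
Local Open Scope classical_set_scope.
Variables (R : realType) (n : nat) (M : matroid [set: 'I_n]%SET).
Variables (s : nat) (cls : 'I_n -> 'I_s).
Hypothesis bases_pair :
  forall B, B \in bases M -> exists x y, [/\ x != y & B = [set x; y]%SET].
Hypothesis basesE :
  forall x y, ([set x; y]%SET \in bases M) = (cls x != cls y).

Lemma sum_pairs (P : pred 'I_n) x y : x != y ->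
  \sum_(i | P i) ((i \in [set x; y]%SET)%:R : R) = (P x)%:R + (P y)%:R.
Proof.
move=> xy; have sum1 w : \sum_(i | P i) ((i == w)%:R : R) = (P w)%:R.
  rewrite big_mkcond (bigD1 w) //= eqxx big1 ?addr0; first by case: (P w).
  by move=> i /negPf ->; case: ifP.
rewrite -!sum1 -big_split; apply: eq_bigr => i _; rewrite !inE.
by case: (eqVneq i x) => [->|_] /=; rewrite ?(negPf xy) ?addr0 ?add0r.
Qed.

(** An outer description of the polytope by inequalities. The converse is established for lattice
    points of dilates, through [polytope_integer_decomposition]. *)
Definition halfspaces : set 'rV[R]_n :=
  [set x | [/\ forall i, 0 <= x 0 i, \sum_i x 0 i = 2
             & forall h, \sum_(i | cls i == h) x 0 i <= 1]].

Lemma convex_halfspaces : @convex_set R 'rV[R]_n halfspaces.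
Proof.
move=> x y l; rewrite !inE => -[x0 x2 x1] [y0 y2 y1].
have l0 : 0 <= l%:num by [].
have l1 : 0 <= 1 - l%:num by rewrite subr_ge0.
rewrite convex_lmodE; split => [i||h].
- by rewrite !mxE addr_ge0 // mulr_ge0.
- under eq_bigr do rewrite !mxE.
  by rewrite big_split /= -!mulr_sumr x2 y2 -mulrDl addrC subrK mul1r.
under eq_bigr do rewrite !mxE.
rewrite big_split /= -!mulr_sumr -[leRHS](subrK l%:num) addrC.
by rewrite lerD // ler_piMr.
Qed.

Lemma polytope_halfspaces : matroid_polytope R M `<=` halfspaces.
Proof.
apply: smallest_sub; first exact: convex_halfspaces.
move=> _ /= [B hB <-]; have [u [v [uv BE]]] := bases_pair hB.
have clsuv : cls u != cls v by rewrite -basesE -BE.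
have sumB (P : pred 'I_n) :
    \sum_(i | P i) indicator_row R B 0 i = (P u)%:R + (P v)%:R.
  by rewrite -sum_pairs //; apply: eq_bigr => i _; rewrite mxE BE.
split => [i||h]; first by rewrite mxE ler0n.
  by rewrite sumB -natrD.
rewrite sumB -natrD lern1; case: (eqVneq (cls u) h) clsuv => [->|_ _]; last by case: (_ == _).
by rewrite eq_sym => /negPf ->.
Qed.

Lemma convex_polytope : @convex_set R 'rV[R]_n (matroid_polytope R M).
Proof.
move=> x y l; rewrite !inE => hx hy C [cC sC].
by have := cC x y l; rewrite !inE; apply; [apply: hx|apply: hy].
Qed.

Lemma indicator_polytope B : B \in bases M -> matroid_polytope R M (indicator_row R B).
Proof. by move=> hB; apply: sub_gen_smallest; exists B. Qed.

(** Induction with [remove_pair]: stripping the indicator [y] of a basis leaves [t] times a point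
    [x] of the polytope, and [f] is [t + 1] times the convex combination of [x] and [y] with weights
    [t / (t + 1)] and [1 / (t + 1)]. *)
Lemma polytope_integer_decomposition (t : nat) (f : 'I_n -> nat) :
  (\sum_i f i = t.*2)%N -> (forall h, \sum_(i | cls i == h) f i <= t)%N ->
  exists2 x, matroid_polytope R M x & t%:R *: x = \row_i (f i)%:R.
Proof.
elim: t f => [|t IH] f sumf f_le.
  (* For [t = 0] the vector is zero, so any vertex, scaled by zero, will do. *)
  have /set0Pn[B hB] := bases_neq0 M.
  exists (indicator_row R B); first exact: indicator_polytope.
  apply/rowP => i; rewrite !mxE mul0r.
  by move/eqP: sumf; rewrite sum_nat_eq0 => /forallP/(_ i)/= /eqP ->.
have [u [v [f' [uv fE sumf' f'_le]]]] := remove_pair sumf f_le.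
have [x Px xE] := IH f' sumf' f'_le.
have t1 : (t.+1%:R : R) != 0 by rewrite pnatr_eq0.
have l0 : 0 <= t%:R / t.+1%:R :> R by rewrite divr_ge0.
have l1 : t%:R / t.+1%:R <= 1 :> R.
  by rewrite ler_pdivrMr ?ltr0Sn // mul1r ler_nat.
pose y := indicator_row R [set u; v]%SET.
exists (conv (Itv01 l0 l1) (x : convex_lmodType 'rV[R]_n) y).
  have := convex_polytope (x := x) (y := y) (Itv01 l0 l1).
  by rewrite !inE; apply => //; apply: indicator_polytope; rewrite basesE.
rewrite convex_lmodE scalerDr !scalerA /= mulrCA divff // mulr1 xE.
rewrite mulrBr mulr1 mulrCA divff // mulr1 -natrB // subSnn scale1r.
by apply/rowP => i; rewrite !mxE fE natrD.
Qed.

Lemma card_eq_finset (T : finType) (X : {set T}) : ([set` X] #= `I_#|X|)%card.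
Proof.
have -> : [set` X] = (@enum_val T (mem X)) @` [set: 'I_#|X|].
  apply/seteqP; split=> [x /= xX|_ /= [i _ <-]]; last exact: enum_valP.
  by exists (enum_rank_in xX x) => //; rewrite enum_rankK_in.
apply: card_eq_trans (card_esym card_II); apply: inj_card_eq.
by move=> i j _ _; exact: enum_val_inj.
Qed.

(** Lattice points have nonnegative integer coordinates of sum [2t], so each coordinate is at most
    [2t] and the finite type of functions loses none of them. *)
Lemma lattice_points_polytope (t : nat) :
  (lattice_points (matroid_polytope R M) t #=
  `I_#|[set f : {ffun 'I_n -> 'I_t.*2.+1} | (\sum_i f i == t.*2)%N
       && [forall h, \sum_(i | cls i == h) f i <= t]%N]%SET|)%card.
Proof.
set G := finset _.
pose g (f : {ffun 'I_n -> 'I_t.*2.+1}) : 'rV[R]_n := \row_i (f i : nat)%:R.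
suff -> : lattice_points (matroid_polytope R M) t = g @` [set` G].
  apply: card_eq_trans (card_eq_finset G); apply: inj_card_eq.
  move=> f1 f2 _ _ /rowP f12; apply/ffunP => i; apply/val_inj/eqP.
  by have := f12 i; rewrite !mxE => /eqP; rewrite eqr_nat.
apply/seteqP; split=> [_ [/= [x Px <-] /mxOverP xint]|_ [f /= fG <-]]; last first.
  move: fG; rewrite inE => /andP[/eqP sumf /forallP f_le].
  have [x Px xE] := polytope_integer_decomposition sumf f_le.
  split; first by exists x.
  by apply/mxOverP => i j; rewrite mxE; exact: intr_nat.
have [x0 x2 x1] := polytope_halfspaces Px.
have [|k kE] := @fin_all_exists 'I_n (fun=> nat) (fun i m => (t%:R *: x) 0 i = m%:R).
  move=> i; apply/natrP; rewrite natrEint xint /=.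
  by rewrite mxE mulr_ge0.
have sumk (P : pred 'I_n) : (\sum_(i | P i) k i)%N%:R = t%:R * \sum_(i | P i) x 0 i.
  by rewrite natr_sum mulr_sumr; apply: eq_bigr => i _; rewrite -kE mxE.
have sum_k : (\sum_i k i = t.*2)%N.
  by apply/eqP; rewrite -(eqr_nat R) sumk x2 -natrM muln2.
have k_le i : (k i < t.*2.+1)%N by rewrite ltnS -sum_k (bigD1 i) //= leq_addr.
exists [ffun i => Ordinal (k_le i)]; last first.
  by apply/rowP => i; rewrite !mxE ffunE /= -kE mxE.
rewrite /= inE; apply/andP; split.
  by under eq_bigr do rewrite ffunE; rewrite /= sum_k.
apply/forallP => h; under eq_bigr do rewrite ffunE /=.
by rewrite -(ler_nat R) sumk -[leRHS]mulr1 ler_wpM2l.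
Qed.

End Polytope.

Theorem theorem1p1 (R : realType) (n : nat) (M : matroid [set: 'I_n]%SET)
    (s : nat) (H : 'I_s -> {set 'I_n}) (a : 'I_s -> nat)
    (hconn : connected_matroid M) (hrk : rk M = 2%N)
    (hinj : injective H) (hH : [set H i | i : 'I_s]%SET = hyperplanes M)
    (ha : forall i, a i = #|H i|) :
  (3 <= s)%N /\
  is_ehrhart_poly (matroid_polytope R M)
    (poly_binom ('X *+ 2 + n%:R - 1) (n - 1) - \sum_(i < s) P_poly (a i) n).
Proof.
have [cls [HE basesE s3]] := hyperplane_classes hconn hrk hinj hH.
split=> // t; eexists.
  by apply: lattice_points_polytope basesE t => B; exact: base2P.
have /set0Pn[B hB] := bases_neq0 M; have [u [v [uv BE]]] := base2P hrk hB.
rewrite {}BE basesE in hB.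
have n0 : (0 < n)%N by exact: leq_ltn_trans (ltn_ord u).
(* No hyperplane is the whole ground set, since the elements [u] and [v] of a basis lie in different
   classes. *)
have a_lt h : (a h < n)%N.
  rewrite ha HE -[ltnRHS]card_ord -cardsT; apply/proper_card.
  rewrite properE finset.subsetT; apply/negP => /fintype.subsetP all_h.
  move: (all_h u (finset.in_setT _)) (all_h v (finset.in_setT _)) hB.
  by rewrite !inE => /eqP -> /eqP ->; rewrite eqxx.
(* Moving the subtracted sum across turns the claim into the additive count [card_ffun_classes_le],
   whose total is given by stars and bars. *)
rewrite hornerD hornerN horner_sum; apply: (canLR (addrK _)).
have -> : \sum_(h < s) (P_poly (a h) n).[t%:R]
    = (\sum_h #|[set f : {ffun 'I_n -> 'I_t.*2.+1} | (\sum_i f i == t.*2)%N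
         && (t < \sum_(i in [set i | cls i == h]%SET) f i)%N]%SET|)%N%:R.
  rewrite natr_sum; apply: eq_bigr => h _.
  by rewrite horner_P_poly // card_ffun_sum_gt card_ord -HE -ha.
rewrite -natrD card_ffun_classes_le card_ffun_sum card_ord // subn1.
apply: horner_poly_binom.
by rewrite !hornerE horner_natr -{1}(prednK n0) -natr1 addrA addrK natrD -muln2
  natrM mulr_natr.
Qed.
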